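(* There are at least two pairwise non-isomorphic Steinitz-Rademacher polyhedra of cardinality 8.
   Context: Let $\pi$ be the unsorted first-order signature with equality consisting of three unary predicates $V$ (''vertex''), $E$ (''edge''), $F$ (''face'') and one binary relation $I$ (''incidence''). The theory $\mathsf{SR}$ consists of the following $\pi$-sentences: (1) there is at least one vertex, at least one edge, and at least one face; (2) every element satisfies $V$, $E$, or $F$; (3) $I$ is symmetric; (4) no two vertices are incident with each other, no two edges are incident with each other, and no two faces are incident with each other; (5) for all $v,e,f$, if $V(v)$, $E(e)$, $F(f)$, $I(v,e)$ and $I(e,f)$, then $I(v,f)$; (6) every edge is incident with exactly two vertices; (7) every edge is incident with exactly two faces; (8) whenever $V(v)$, $F(f)$ and $I(v,f)$, there are exactly two edges incident with both $v$ and $f$; (9) every vertex and every face is incident with at least one other element. A Steinitz-Rademacher polyhedron is a $\pi$-structure satisfying all sentences of $\mathsf{SR}$; its cardinality is the cardinality of its domain. *)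

(* Defs.v *)
From mathcomp Require Import all_boot.

Set Implicit Arguments.
Unset Strict Implicit.
Unset Printing Implicit Defensive.

Record pi_structure := PiStructure {
  dom :> Type;
  V : dom -> Prop;
  E : dom -> Prop;
  F : dom -> Prop;
  I : dom -> dom -> Prop
}.

Arguments V {_} _.
Arguments E {_} _.
Arguments F {_} _.
Arguments I {_} _ _.

Definition exactly_two (T : Type) (P : T -> Prop) : Prop :=
  exists x y : T,
    [/\ x <> y, P x, P y & forall z : T, P z -> z = x \/ z = y].

(* V, E and F are not required to be mutually exclusive.  In [SR_types],
   x and y may coincide, so no element is incident with itself. *)
Record SR (M : pi_structure) : Prop := {
  SR_nonempty : [/\ exists v : M, V v, exists e : M, E e & exists f : M, F f];
  SR_cover : forall x : M, [\/ V x, E x | F x];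
  SR_sym : forall x y : M, I x y -> I y x;
  SR_types : [/\ forall x y : M, V x -> V y -> ~ I x y,
                 forall x y : M, E x -> E y -> ~ I x y
               & forall x y : M, F x -> F y -> ~ I x y];
  SR_trans : forall v e f : M,
    V v -> E e -> F f -> I v e -> I e f -> I v f;
  SR_edge_vertices : forall e : M,
    E e -> exactly_two (fun v : M => V v /\ I e v);
  SR_edge_faces : forall e : M,
    E e -> exactly_two (fun f : M => F f /\ I e f);
  SR_vertex_face : forall v f : M,
    V v -> F f -> I v f ->
    exactly_two (fun e : M => [/\ E e, I e v & I e f]);
  SR_incident : forall x : M,
    V x \/ F x -> exists y : M, y <> x /\ I x y
}.

Definition has_cardinality (M : pi_structure) (n : nat) : Prop :=
  exists f : 'I_n -> M, bijective f.

Definition isomorphic (M N : pi_structure) : Prop :=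
  exists f : M -> N,
    [/\ bijective f,
        forall x : M, V x <-> V (f x),
        forall x : M, E x <-> E (f x),
        forall x : M, F x <-> F (f x)
      & forall x y : M, I x y <-> I (f x) (f y)].

(* Main.v *)
Require Import Defs.
From mathcomp Require Import all_boot.

Set Implicit Arguments.
Unset Strict Implicit.
Unset Printing Implicit Defensive.

(** The triangle drawn on the sphere has 3 vertices, 3 edges and 2 faces.  The
    axioms are invariant under exchanging vertices and faces, so its dual is
    also a Steinitz-Rademacher polyhedron on the same 8 elements.  An
    isomorphism between the two would inject 3 vertices into 2 faces. *)

Definition dual (M : pi_structure) : pi_structure :=
  @PiStructure M (@F M) (@E M) (@V M) (@I M).

Lemma exactly_two_ext (T : Type) (P Q : T -> Prop) :
  (forall x, P x <-> Q x) -> exactly_two P -> exactly_two Q.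
Proof.
move=> PQ [x [y [xy Px Py Pxy]]]; exists x, y.
by split=> // [||z /PQ]; [exact/PQ | exact/PQ | exact: Pxy].
Qed.

(** Carries a count made in ['I_3] or [bool] over to the corresponding summand of the carrier of
    [triangle]. *)
Lemma exactly_two_image (T U : Type) (h : T -> U) (P : T -> Prop)
    (Q : U -> Prop) :
  injective h -> (forall y, Q y <-> exists2 x, P x & y = h x) ->
  exactly_two P -> exactly_two Q.
Proof.
move=> h_inj QE [x [y [xy Px Py Pxy]]]; exists (h x), (h y); split.
- by move/h_inj.
- by apply/QE; exists x.
- by apply/QE; exists y.
- by move=> _ /QE[z /Pxy[]-> ->]; [left | right].
Qed.

(** The two edge axioms trade places; transitivity and the vertex-face axiom return to themselves
    once incidences are reversed by symmetry. *)
Lemma SR_dual (M : pi_structure) : SR M -> SR (dual M).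
Proof.
case=> [[exV exE exF] cov sym [nVV nEE nFF] tr ev ef vf inc]; split=> //=.
- by move=> x; case: (cov x); [constructor 3 | constructor 2 | constructor 1].
- move=> f e v Ff Ee Vv Ife Iev.
  by apply: (sym v f); apply: (tr v e f) => //; exact: sym.
- move=> f v Ff Vv Ifv; apply: exactly_two_ext (vf _ _ Vv Ff (sym _ _ Ifv)) => e.
  by split=> -[].
- by move=> x xFV; apply: inc; case: xFV; [right | left].
Qed.

(* Edge [i] of the triangle is the one opposite to vertex [i]. *)
Definition triangle_incidence (x y : 'I_3 + 'I_3 + bool) : bool :=
  match x, y with
  | inl (inl v), inl (inr e) | inl (inr e), inl (inl v) => v != e
  | inl _, inr _ | inr _, inl _ => true
  | _, _ => false
  end.

(** The booleans stand for the two hemispheres bounded by the triangle, so each face touches every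
    vertex and every edge. *)
Definition triangle : pi_structure :=
  @PiStructure ('I_3 + 'I_3 + bool)%type
    (fun x => if x is inl (inl _) then True else False)
    (fun x => if x is inl (inr _) then True else False)
    (fun x => if x is inr _ then True else False)
    (fun x y => triangle_incidence x y).

Lemma exactly_two_neq_ord3 (i : 'I_3) : exactly_two (fun j : 'I_3 => j != i).
Proof.
have /cards2P[x [y [xy ixy]]] : #|[set~ i]| == 2 by rewrite cardsC1 card_ord.
have mem j : (j != i) = (j == x) || (j == y) by rewrite -in_setC1 ixy in_set2.
exists x, y; split; rewrite ?mem ?eqxx ?orbT //; first exact/eqP.
by move=> z; rewrite mem => /orP[]/eqP->; [left | right].
Qed.

Lemma exactly_two_bool : exactly_two (fun _ : bool => True).
Proof. by exists true, false; split=> // -[]; [left | right]. Qed.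

Lemma SR_triangle : SR triangle.
Proof.
have v_inj : injective (fun i : 'I_3 => inl (inl i) : triangle) by move=> ? ? [].
have e_inj : injective (fun i : 'I_3 => inl (inr i) : triangle) by move=> ? ? [].
have f_inj : injective (fun b : bool => inr b : triangle) by move=> ? ? [].
split.
- split; first by exists (inl (inl ord0)).
    by exists (inl (inr ord0)).
  by exists (inr true).
- by case=> [[v|e]|f]; [constructor 1 | constructor 2 | constructor 3].
- by case=> [[v|e]|f] [[v'|e']|f'].
- by split; case=> [[v|e]|f] [[v'|e']|f'].
(* Transitivity is immediate: every vertex is incident with every face. *)
- by case=> [[v|e]|f] [[v'|e']|f'] [[v''|e'']|f''].
- case=> [[v|e]|f] // _.
  apply: (exactly_two_image v_inj) (exactly_two_neq_ord3 e) => y; split.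
    by case: y => [[v|e']|f] [] //=; exists v.
  by case=> v ve ->.
- case=> [[v|e]|f] // _.
  apply: (exactly_two_image f_inj) exactly_two_bool => y; split.
    by case: y => [[v|e']|f] [] //=; exists f.
  by case=> f _ ->.
(* The face imposes no constraint, so the edges to count are those at [v]: the ones whose index
   differs from [v]. *)
- case=> [[v|e]|f] // [[v'|e']|f'] // _ _ _.
  apply: (exactly_two_image e_inj) (exactly_two_neq_ord3 v) => y; split.
    by case: y => [[v'|e]|f] [] //= _ ve _; exists e; rewrite // eq_sym.
  by case=> e ev ->; split; rewrite //= eq_sym.
- case=> [[v|e]|f] [] // _; first by exists (inr true).
  by exists (inl (inl ord0)).
Qed.

Lemma triangle_card : has_cardinality triangle 8.
Proof.
have card8 : 8 = #|{: 'I_3 + 'I_3 + bool}|.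
  by rewrite !card_sum !card_ord card_bool.
rewrite /has_cardinality card8; exists enum_val.
exact: enum_val_bij.
Qed.

Lemma triangle_not_self_dual : ~ isomorphic triangle (dual triangle).
Proof.
case=> f [/bij_inj f_inj fV _ _ _].
(* The default [true] is never reached: [f] sends vertices to vertices of the dual, which are the
   faces [inr b]. *)
pose g (v : 'I_3) := if f (inl (inl v)) is inr b then b else true.
have fg v : f (inl (inl v)) = inr (g v).
  by rewrite /g; case: (f _) (fV (inl (inl v))) => [[u|e]|b] // -[/(_ Logic.I)].
have g_inj : injective g.
  by move=> u v guv; have /f_inj[] : f (inl (inl u)) = f (inl (inl v)) by rewrite !fg guv.
by have := leq_card g g_inj; rewrite card_ord card_bool.
Qed.

Theorem theorem6 :
  exists M N : pi_structure,
    [/\ SR M, SR N, has_cardinality M 8, has_cardinality N 8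
      & ~ isomorphic M N].
Proof.
exists triangle, (dual triangle); split.
- exact: SR_triangle.
- exact: SR_dual SR_triangle.
- exact: triangle_card.
(* The dual has the same carrier, so the same bijection serves by conversion. *)
- exact: triangle_card.
- exact: triangle_not_self_dual.
Qed.
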